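(* Let $\mathcal{C}_{\mathbf 0}$ be a unitary modular tensor category with group of Abelian anyons $\mathcal{A}$, and consider for a group $G$ and an $\mathcal{A}$-valued 2-cocycle $\mathfrak{w}$ the equation for a $U(1)$-valued function $F^{0_{\mathbf g}0_{\mathbf h}0_{\mathbf k}}$ on $G^3$ $$\frac{F^{0_{\mathbf{gh}}0_{\mathbf k}0_{\mathbf l}}F^{0_{\mathbf g}0_{\mathbf h}0_{\mathbf{kl}}}}{F^{0_{\mathbf g}0_{\mathbf h}0_{\mathbf k}}F^{0_{\mathbf g}0_{\mathbf{hk}}0_{\mathbf l}}F^{0_{\mathbf h}0_{\mathbf k}0_{\mathbf l}}}=\mathcal{O}(\mathbf g,\mathbf h,\mathbf k,\mathbf l)\qquad(\ast)$$ with $$\mathcal{O}(\mathbf g,\mathbf h,\mathbf k,\mathbf l)=\frac{F^{\mathfrak{w}(\mathbf g,\mathbf h)\mathfrak{w}(\mathbf k,\mathbf l)\mathfrak{w}(\mathbf{gh},\mathbf{kl})}}{F^{\mathfrak{w}(\mathbf k,\mathbf l)\mathfrak{w}(\mathbf g,\mathbf h)\mathfrak{w}(\mathbf{gh},\mathbf{kl})}}\frac{F^{\mathfrak{w}(\mathbf k,\mathbf l)\mathfrak{w}(\mathbf h,\mathbf{kl})\mathfrak{w}(\mathbf g,\mathbf{hkl})}}{F^{\mathfrak{w}(\mathbf h,\mathbf k)\mathfrak{w}(\mathbf{hk},\mathbf l)\mathfrak{w}(\mathbf g,\mathbf{hkl})}}\frac{F^{\mathfrak{w}(\mathbf h,\mathbf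 k)\mathfrak{w}(\mathbf g,\mathbf{hk})\mathfrak{w}(\mathbf{ghk},\mathbf l)}}{F^{\mathfrak{w}(\mathbf g,\mathbf h)\mathfrak{w}(\mathbf{gh},\mathbf k)\mathfrak{w}(\mathbf{ghk},\mathbf l)}}R^{\mathfrak{w}(\mathbf g,\mathbf h)\mathfrak{w}(\mathbf k,\mathbf l)} .$$ (a) Let $G=U(1)$, $v\in\mathcal{A}$, $\mathbf g_i=e^{2\pi i z_i}$ with $z_i\in[0,1)$, and $\mathfrak{w}(\mathbf g_1,\mathbf g_2)=v^{z_1+z_2-[z_1+z_2]}$, where $[x]$ is the fractional part of $x$. Then $\mathcal{O}(\mathbf g,\mathbf h,\mathbf k,\mathbf l)=R^{\mathfrak{w}(\mathbf g,\mathbf h)\mathfrak{w}(\mathbf k,\mathbf l)}$, and for every $k_1\in\mathbb{Z}$ $$F^{0_{\mathbf g_1}0_{\mathbf g_2}0_{\mathbf g_3}}=e^{-2\pi i\left(\frac{v\star v}{2}+k_1\right)z_1(z_2+z_3-[z_2+z_3])}$$ solves $(\ast)$. (b) Let $G=\mathbb{Z}_M$, $s\in\mathcal{A}$, $\mathbf g_i=e^{2\pi i h_i/M}$ with $h_i\in\{0,\dots,M-1\}$, and $\mathfrak{w}(\mathbf g_1,\mathbf g_2)=s^{(h_1+h_2-[h_1+h_2]_M)/M}$, where $[x]_M$ is the residue of $x$ mod $M$ in $\{0,\dots,M-1\}$. Then $\mathcal{O}(\mathbf g,\mathbf h,\mathbf k,\mathbf l)=R^{\mathfrak{w}(\mathbf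 g,\mathbf h)\mathfrak{w}(\mathbf k,\mathbf l)}$, and for every $k_3\in\mathbb{Z}$ $$F^{0_{\mathbf g_1}0_{\mathbf g_2}0_{\mathbf g_3}}=e^{-\frac{2\pi i}{M^2}\left(\frac{s\star s}{2}+k_3\right)h_1(h_2+h_3-[h_2+h_3]_M)}$$ solves $(\ast)$.
   Context: $F^{abc}$ and $R^{ab}$ for $a,b,c\in\mathcal{A}$ are the ($U(1)$-valued) $F$- and $R$-symbols of the Abelian anyons of $\mathcal{C}_{\mathbf 0}$, in a gauge where they equal 1 if one of the arguments is the trivial anyon. In these formulas $\frac{v\star v}{2}$ denotes the topological spin $h_v\in[0,1)$ of $v$, defined by $e^{2\pi i h_v}=\theta_v=R^{v,v}$ (and likewise for $s$). In the theory of $G$-crossed braided tensor categories with non-permuting symmetry, $(\ast)$ is the equation for the defect $F$-symbols $F^{0_{\mathbf g}0_{\mathbf h}0_{\mathbf k}}$ which, together with $\mathfrak{w}$ and the data of $\mathcal{C}_{\mathbf 0}$, determines a full solution of the consistency equations. *)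

(* Defs.v *)
From HB Require Import structures.
From mathcomp Require Import all_boot all_order all_algebra.
From mathcomp Require Import complex.
From mathcomp Require Import all_classical all_reals all_analysis.

Set Implicit Arguments.
Unset Strict Implicit.
Unset Printing Implicit Defensive.

Import Order.TTheory GRing.Theory Num.Theory.
Local Open Scope classical_set_scope.
Local Open Scope ring_scope.

(** * Skeletal unitary modular tensor categories

   A unitary modular tensor category is given by its skeletal data. The basis
   vectors of the splitting space V_c^{ab} are numbered 0, ..., N_{ab}^c - 1, and
   the F- and R-symbols are total functions of which only the entries whose
   multiplicity labels are in range are meaningful. Conventions:

     ((ab)_e^x c)_d^y = sum_(f,u,v)
        Fsym a b c d (e,x,y) (f,u,v) * (a (bc)_f^u)_d^v
     R (ab)_c^x       = sum_u  Rsym a b c x u * (ba)_c^u. *)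

Record skeleton (R : realType) := Skeleton {
  anyon :> finType;
  vac   : anyon;
  dual  : anyon -> anyon;
  fus   : anyon -> anyon -> anyon -> nat;
  Fsym  : anyon -> anyon -> anyon -> anyon ->
          anyon * nat * nat -> anyon * nat * nat -> R[i];
  Rsym  : anyon -> anyon -> anyon -> nat -> nat -> R[i] }.

Arguments vac {R} s.
Arguments dual {R s}.
Arguments fus {R s}.
Arguments Fsym {R s}.
Arguments Rsym {R s}.

Section ModularData.
Variables (R : realType) (C : skeleton R).
Local Notation I := (anyon C).
Local Notation vac := (vac C).
Local Notation N := (@fus R C).
Local Notation F := (@Fsym R C).
Implicit Types a b c d e f g h k l : I.

Definition fusion_ring : Prop :=
  [/\ forall a b, N vac a b = (a == b) /\ N a vac b = (a == b),
      forall a b, N a b vac = (b == dual a),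
      forall a b c, N a b c = N b a c
    & forall a b c d,
        (\sum_e N a b e * N e c d = \sum_f N b c f * N a f d)%N].

(* The gauge in which every F-symbol with a trivial upper leg is trivial. For the
   R-symbols the analogous property follows from the hexagons. *)
Definition F_normalized : Prop :=
  [/\ forall b c d (x u : 'I_(N b c d)),
        F vac b c d (b, 0, x : nat)%N (d, u : nat, 0)%N = (x == u)%:R,
      forall a c d (x u : 'I_(N a c d)),
        F a vac c d (a, 0, x : nat)%N (c, 0, u : nat)%N = (x == u)%:R
    & forall a b d (x u : 'I_(N a b d)),
        F a b vac d (d, x : nat, 0)%N (b, 0, u : nat)%N = (x == u)%:R].

(* By associativity of the fusion rules these matrices are square, so the
   orthonormality of the rows suffices. *)
Definition F_unitary : Prop :=
  forall a b c d e e' (x : 'I_(N a b e)) (y : 'I_(N e c d))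
         (x' : 'I_(N a b e')) (y' : 'I_(N e' c d)),
    \sum_f \sum_(u < N b c f) \sum_(v < N a f d)
       F a b c d (e, x : nat, y : nat) (f, u : nat, v : nat)
         * (F a b c d (e', x' : nat, y' : nat) (f, u : nat, v : nat))^*
    = ((e, x : nat, y : nat) == (e', x' : nat, y' : nat))%:R.

Definition pentagon : Prop :=
  forall a b c d e f g k l
         (x : 'I_(N a b f)) (y : 'I_(N f c g)) (z : 'I_(N g d e))
         (v : 'I_(N c d l)) (u : 'I_(N b l k)) (w : 'I_(N a k e)),
    \sum_(t < N f l e)
       F f c d e (g, y : nat, z : nat) (l, v : nat, t : nat)
         * F a b l e (f, x : nat, t : nat) (k, u : nat, w : nat)
    = \sum_h \sum_(s < N b c h) \sum_(p < N a h g) \sum_(r < N h d k)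
       F a b c g (f, x : nat, y : nat) (h, s : nat, p : nat)
         * F a h d e (g, p : nat, z : nat) (k, r : nat, w : nat)
         * F b c d k (h, s : nat, r : nat) (l, v : nat, u : nat).

Definition R_unitary : Prop :=
  forall a b c (x y : 'I_(N a b c)),
    \sum_(u < N b a c) Rsym a b c x u * (Rsym a b c y u)^* = (x == y)%:R.

Definition hexagon_for (B : I -> I -> I -> nat -> nat -> R[i]) : Prop :=
  forall a b c d e g (x : 'I_(N c a e)) (y : 'I_(N e b d))
         (u : 'I_(N b c g)) (v : 'I_(N a g d)),
    \sum_(s < N a c e) \sum_(t < N c b g)
       B c a e x s * F a c b d (e, s : nat, y : nat) (g, t : nat, v : nat)
         * B c b g t u
    = \sum_f \sum_(s < N a b f) \sum_(p < N c f d) \sum_(q < N f c d)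
       F c a b d (e, x : nat, y : nat) (f, s : nat, p : nat) * B c f d p q
         * F a b c d (f, s : nat, q : nat) (g, u : nat, v : nat).

(* The second hexagon is the first one for the inverse braiding, whose matrix is
   the conjugate transpose. *)
Definition hexagons : Prop :=
  hexagon_for (@Rsym R C)
  /\ hexagon_for (fun a b c x u => (Rsym b a c u x)^*).

Definition rigid : Prop :=
  forall a, F a (dual a) a a (vac, 0, 0)%N (vac, 0, 0)%N != 0.

Definition qdim a : R[i] := `|F a (dual a) a a (vac, 0, 0)%N (vac, 0, 0)%N|^-1.

(* S_ab is the quantum trace of the double braiding of a and b. *)
Definition Smatrix : 'M[R[i]]_#|I| :=
  \matrix_(i, j) let a := enum_val i in let b := enum_val j in
    \sum_c qdim c
      * \sum_(x < N a b c) \sum_(u < N b a c) Rsym a b c x u * Rsym b a c u x.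

Definition modular : Prop := Smatrix \in unitmx.

End ModularData.

Record umtc (R : realType) := UMTC {
  umtc_skel :> skeleton R;
  umtc_fusion : fusion_ring umtc_skel;
  umtc_Fnorm : F_normalized umtc_skel;
  umtc_Funit : F_unitary umtc_skel;
  umtc_pentagon : pentagon umtc_skel;
  umtc_Runit : R_unitary umtc_skel;
  umtc_hexagons : hexagons umtc_skel;
  umtc_rigid : rigid umtc_skel;
  umtc_modular : modular umtc_skel }.

(** * The group of Abelian anyons *)

Definition abelian_anyon (R : realType) (C : skeleton R) (a : C) : bool :=
  [forall b : C, \sum_(c : C) fus a b c == 1]%N.

Definition fuse (R : realType) (C : skeleton R) (a b : C) : C :=
  odflt (vac C) [pick c | fus a b c == 1%N].

Section AbelianAnyons.
Variables (R : realType) (C : umtc R).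
Local Notation N := (@fus R C).
Implicit Types a b c : C.

Lemma fuseP a b : abelian_anyon a -> forall c, N a b c = (c == fuse a b).
Proof.
move=> /forallP /(_ b) /eqP ab1.
have [c0 Nc0] : exists c, N a b c == 1%N.
  have /existsP [c nz] : [exists c, N a b c != 0%N].
    apply: contraPT ab1 => /existsPn N0.
    by rewrite big1 // => c _; apply/eqP; have := N0 c; rewrite negbK.
  exists c; rewrite eqn_leq lt0n nz andbT -ab1 (bigD1 c) //=; exact: leq_addr.
have eqN c : N a b c = (c == c0).
  have [->|nc] := eqVneq c c0; first exact/eqP.
  move: ab1; rewrite (bigD1 c0) //= (eqP Nc0) add1n => -[/eqP].
  by rewrite sum_nat_eq0 => /forallP /(_ c); rewrite nc => /eqP.
move=> c; rewrite eqN /fuse; case: pickP => [c1|/(_ c0)]; last by rewrite Nc0.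
by rewrite eqN; have [->|] := eqVneq c1 c0.
Qed.

Lemma fus_assoc a b c d :
  (\sum_e N a b e * N e c d = \sum_f N b c f * N a f d)%N.
Proof. by case: (umtc_fusion C). Qed.

Lemma sum_fus_assoc a b c :
  (\sum_e N a b e * \sum_d N e c d = \sum_f N b c f * \sum_d N a f d)%N.
Proof.
under eq_bigr do rewrite big_distrr /=.
rewrite exchange_big; under eq_bigr do rewrite fus_assoc.
by rewrite exchange_big; apply: eq_bigr => f _; rewrite big_distrr.
Qed.

Lemma sum_fuseE a b (G : C -> nat) : abelian_anyon a ->
  (\sum_e N a b e * G e = G (fuse a b))%N.
Proof.
move=> ha; rewrite (bigD1 (fuse a b)) //= fuseP // eqxx mul1n big1 ?addn0 //.
by move=> c /negPf nc; rewrite fuseP // nc mul0n.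
Qed.

Lemma vac_abelian : abelian_anyon (vac C).
Proof.
apply/forallP => b; case: (umtc_fusion C) => unit _ _ _.
rewrite (bigD1 b) //= (unit b b).1 eqxx big1 // => c nc.
by rewrite (unit b c).1 eq_sym (negPf nc).
Qed.

Lemma fuse_abelian a b :
  abelian_anyon a -> abelian_anyon b -> abelian_anyon (fuse a b).
Proof.
move=> ha hb; apply/forallP => c.
rewrite -(sum_fuseE b (fun e => \sum_d N e c d)%N ha) sum_fus_assoc sum_fuseE //.
by move/forallP: ha => /(_ (fuse b c)).
Qed.

Lemma fuse_dual a : abelian_anyon a -> fuse a (dual a) = vac C.
Proof.
move=> ha; case: (umtc_fusion C) => _ dualE _ _.
by move: (dualE a (dual a)); rewrite fuseP // eqxx; case: eqVneq.
Qed.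

Lemma dual_abelian a : abelian_anyon a -> abelian_anyon (dual a).
Proof.
move=> ha; apply/forallP => c.
have := sum_fus_assoc a (dual a) c; rewrite sum_fuseE // fuse_dual //.
have /forallP /(_ c) /eqP -> := vac_abelian => /esym.
by under eq_bigr => f _ do rewrite (eqP (forallP ha f)) muln1; move=> ->.
Qed.

Definition abAnyon := {a : C | abelian_anyon a}.

HB.instance Definition _ := SubFinite.on abAnyon.

Definition ab_zero : abAnyon := Sub (vac C) vac_abelian.
Definition ab_add (a b : abAnyon) : abAnyon :=
  Sub (fuse (val a) (val b)) (fuse_abelian (valP a) (valP b)).
Definition ab_opp (a : abAnyon) : abAnyon :=
  Sub (dual (val a)) (dual_abelian (valP a)).

Lemma ab_addC : commutative ab_add.
Proof.
move=> a b; apply: val_inj; apply/eqP => /=.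
case: (umtc_fusion C) => _ _ comm _.
have := comm (val a) (val b) (fuse (val a) (val b)).
by rewrite (fuseP _ (valP a)) (fuseP _ (valP b)) eqxx; case: eqVneq.
Qed.

Lemma ab_addA : associative ab_add.
Proof.
move=> a b c; apply: val_inj; apply/eqP => /=.
set d := fuse _ _; have := fus_assoc (val a) (val b) (val c) d.
rewrite !(sum_fuseE _ (fun e => N _ e _)) ?(sum_fuseE _ (fun e => N e _ _));
  rewrite ?(valP a) ?(valP b) //.
rewrite (fuseP _ (valP a)) (fuseP _ (fuse_abelian (valP a) (valP b))) eqxx.
by case: eqVneq.
Qed.

Lemma ab_add0 : left_id ab_zero ab_add.
Proof.
move=> a; apply: val_inj; apply/eqP => /=.
case: (umtc_fusion C) => unit _ _ _.
have := (unit (val a) (val a)).1.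
by rewrite (fuseP _ vac_abelian) eqxx eq_sym; case: eqVneq.
Qed.

Lemma ab_addN : left_inverse ab_zero ab_opp ab_add.
Proof.
move=> a; rewrite ab_addC; apply: val_inj => /=; exact: fuse_dual (valP a).
Qed.

HB.instance Definition _ :=
  GRing.isZmodule.Build abAnyon ab_addA ab_addC ab_add0 ab_addN.

(* Between Abelian anyons the F- and R-matrices are 1 x 1; the group of Abelian
   anyons is written additively. *)
Definition Fab (a b c : abAnyon) : R[i] :=
  Fsym (val a) (val b) (val c) (val (a + b + c))
    (val (a + b), 0%N, 0%N) (val (b + c), 0%N, 0%N).
Definition Rab (a b : abAnyon) : R[i] :=
  Rsym (val a) (val b) (val (a + b)) 0%N 0%N.

End AbelianAnyons.

(** * Phases *)

Section Phases.
Variable R : realType.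

Definition expi (t : R) : R[i] := (cos t +i* sin t)%C.

(* For |w| = 1, the unique z in [0, 1) with w = e^(2 pi i z). *)
Definition phase (w : R[i]) : R :=
  xget 0 [set z : R | 0 <= z < 1 /\ w = expi (2 * pi * z)].

Definition frac (x : R) : R := x - (Num.floor x)%:~R.

Definition U1 := {z : R[i] | `|z| == 1}.
HB.instance Definition _ := SubChoice.on U1.

Lemma U1_one_proof : `|1 : R[i]| == 1. Proof. by rewrite normr1. Qed.
Lemma U1_mul_proof (g h : U1) : `|val g * val h| == 1.
Proof. by rewrite normrM (eqP (valP g)) (eqP (valP h)) mul1r. Qed.
Lemma U1_inv_proof (g : U1) : `|(val g)^-1| == 1.
Proof. by rewrite normfV (eqP (valP g)) invr1. Qed.

Definition U1_one : U1 := exist _ 1 U1_one_proof.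
Definition U1_mul (g h : U1) : U1 := exist _ (val g * val h) (U1_mul_proof g h).
Definition U1_inv (g : U1) : U1 := exist _ (val g)^-1 (U1_inv_proof g).

Lemma U1_mulA : associative U1_mul.
Proof. by move=> g h k; apply: val_inj; rewrite /= mulrA. Qed.
Lemma U1_mul1 : left_id U1_one U1_mul.
Proof. by move=> g; apply: val_inj; rewrite /= mul1r. Qed.
Lemma U1_mulr1 : right_id U1_one U1_mul.
Proof. by move=> g; apply: val_inj; rewrite /= mulr1. Qed.
Lemma U1_neq0 (g : U1) : val g != 0.
Proof. by rewrite -normr_eq0 (eqP (valP g)) oner_eq0. Qed.
Lemma U1_mulV : left_inverse U1_one U1_inv U1_mul.
Proof. by move=> g; apply: val_inj; rewrite /= mulVf ?U1_neq0. Qed.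
Lemma U1_mulrV : right_inverse U1_one U1_inv U1_mul.
Proof. by move=> g; apply: val_inj; rewrite /= divff ?U1_neq0. Qed.

HB.instance Definition _ :=
  isGroup.Build U1 U1_mulA U1_mul1 U1_mulr1 U1_mulV U1_mulrV.

(* Z_M as the group of M-th roots of unity. *)
Definition Zroot (M : nat) := {g : U1 | (g ^+ M == 1)%g}.
HB.instance Definition _ M := SubChoice.on (Zroot M).

Lemma Zroot_closed M : group_closed [pred g : U1 | (g ^+ M == 1)%g].
Proof.
split=> [|g h]; rewrite !inE ?expg1n // => /eqP gM /eqP hM.
have gC (x y : U1) : commute x y by apply: val_inj; rewrite /= mulrC.
by rewrite expgMn ?expVgn ?gM ?hM ?invg1 ?mulg1.
Qed.

HB.instance Definition _ M :=
  SubChoice_isSubGroup.Build U1 _ (Zroot M) (Zroot_closed M).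

(* For g an M-th root of unity, the unique h < M with g = e^(2 pi i h / M). *)
Definition residue (M : nat) (g : Zroot M) : nat :=
  xget 0%N [set h : nat | (h < M)%N /\
                          val (val g) = expi (2 * pi * h%:R / M%:R)].

End Phases.

(** * The equation for the defect F-symbols *)

Section Obstruction.
Variables (R : realType) (C : umtc R) (G : groupType).
Local Notation A := (abAnyon C).
Implicit Types (g h k l : G) (w : G -> G -> A).

(* The symmetry does not permute the anyons, so G acts trivially on A. *)
Definition cocycle2 w : Prop :=
  forall g h k, w g h + w (g * h)%g k = w h k + w g (h * k)%g.

Definition obstruction w g h k l : R[i] :=
  Fab (w g h) (w k l) (w (g * h)%g (k * l)%g)
    / Fab (w k l) (w g h) (w (g * h)%g (k * l)%g)
  * (Fab (w k l) (w h (k * l)%g) (w g (h * k * l)%g)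
    / Fab (w h k) (w (h * k)%g l) (w g (h * k * l)%g))
  * (Fab (w h k) (w g (h * k)%g) (w (g * h * k)%g l)
    / Fab (w g h) (w (g * h)%g k) (w (g * h * k)%g l))
  * Rab (w g h) (w k l).

Definition defectF_solution w (F : G -> G -> G -> R[i]) : Prop :=
  (forall g h k, `|F g h k| = 1) /\
  forall g h k l,
    F (g * h)%g k l * F g h (k * l)%g / (F g h k * F g (h * k)%g l * F h k l)
    = obstruction w g h k l.

End Obstruction.

Section Examples.
Variables (R : realType) (C : umtc R).
Local Notation A := (abAnyon C).

(* h_v in [0, 1) with e^(2 pi i h_v) = theta_v; the twist of an Abelian anyon v
   is R^{v,v}. *)
Definition spin (v : A) : R := phase (Rab v v).

(* The argument of Num.floor is an integer. *)
Definition wU1 (v : A) (g1 g2 : U1 R) : A :=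
  let z1 := phase (val g1) in let z2 := phase (val g2) in
  v *~ Num.floor (z1 + z2 - frac (z1 + z2)).

Definition FU1 (v : A) (k1 : int) (g1 g2 g3 : U1 R) : R[i] :=
  let z1 := phase (val g1) in
  let z2 := phase (val g2) in
  let z3 := phase (val g3) in
  expi (- (2 * pi * (spin v + k1%:~R) * z1 * (z2 + z3 - frac (z2 + z3)))).

Variable M : nat.

Definition wZ (s : A) (g1 g2 : Zroot R M) : A :=
  let h1 := residue g1 in let h2 := residue g2 in
  s *+ ((h1 + h2 - (h1 + h2) %% M) %/ M)%N.

Definition FZ (s : A) (k3 : int) (g1 g2 g3 : Zroot R M) : R[i] :=
  let h1 := residue g1 in
  let h2 := residue g2 in
  let h3 := residue g3 in
  expi (- (2 * pi / M%:R ^+ 2 * (spin s + k3%:~R)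
           * (h1 * (h2 + h3 - (h2 + h3) %% M))%N%:R)).

End Examples.

(* Main.v *)
(* Both groups carry a real coordinate z with z(gh) = z(g) + z(h) - c(g,h), where the
   carry c(g,h) is 1 if z(g) + z(h) >= 1 and 0 otherwise (z = h/M for Z_M), and w = c v.
   Every F- and R-symbol in O thus has all its arguments in {0, v}, so it is 1 unless
   all of them are v. Associativity gives
     c(g,h) + c(gh,k) = c(h,k) + c(g,hk),
   and as the carries are 0 or 1 the two products c(g,h) c(gh,k) and c(h,k) c(g,hk)
   agree as well, so the F-symbols in O cancel. The exponents of the F-symbols
   e^(-2 pi i q z(g) c(h,k)), with q = h_v + k_1, telescope to q c(g,h) c(k,l), and
   e^(2 pi i q) = R^{v,v}. *)

Require Import Defs.
From HB Require Import structures.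
From mathcomp Require Import all_boot all_order all_algebra.
From mathcomp Require Import complex ring zify ring lra.
From mathcomp Require Import all_classical all_reals all_analysis.

Set Implicit Arguments.
Unset Strict Implicit.
Unset Printing Implicit Defensive.

Import Order.TTheory GRing.Theory Num.Theory.
Local Open Scope ring_scope.

Local Notation frac := Defs.frac.

(** * [F]- and [R]-symbols of Abelian anyons: unit modulus, and value 1 at the trivial anyon *)

Section AbelianSymbols.
Variables (R : realType) (C : umtc R).
Local Notation A := (abAnyon C).
Implicit Types a b c d : A.

Lemma fus_ab a b (c : C) : fus (val a) (val b) c = (c == val (a + b)%R).
Proof. exact: fuseP (valP a) c. Qed.

Lemma fus_ab_gt0 a b : (0 < fus (val a) (val b) (val (a + b)%R))%N.
Proof. by rewrite fus_ab eqxx. Qed.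

(** Abelian fusion has a single outcome of multiplicity one, so the sums in the unitarity and
    hexagon axioms collapse to the label 0. *)
Lemma sum_fus_ab a b d (G : nat -> R[i]) : d = a + b ->
  \sum_(x < fus (val a) (val b) (val d)) G x = G 0%N.
Proof. by move=> ->; rewrite fus_ab eqxx big_ord1. Qed.

Lemma sum_anyon_fus_ab a b (G : C -> nat -> R[i]) :
  \sum_(c : C) \sum_(x < fus (val a) (val b) c) G c x = G (val (a + b)) 0%N.
Proof.
rewrite (bigD1 (val (a + b))) // (sum_fus_ab (G (val (a + b)))) //
  big1 => [|c /negPf nc]; first exact: addr0.
by rewrite fus_ab nc big_ord0.
Qed.

Lemma Fab_norm a b c : `|Fab a b c| = 1.
Proof.
pose x := Ordinal (fus_ab_gt0 a b).
pose y := Ordinal (fus_ab_gt0 (a + b) c).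
pose F f u v := Fsym (val a) (val b) (val c) (val (a + b + c))
  (val (a + b), 0%N, 0%N) (f, u, v).
have := @umtc_Funit R C (val a) (val b) (val c) _ _ _ x y x y.
rewrite eqxx (sum_anyon_fus_ab b c
  (fun f u => \sum_(v < fus (val a) f (val (a + b + c))) F f u v * (F f u v)^*)).
rewrite (sum_fus_ab (fun v => F _ _ v * (F _ _ v)^*)) ?addrA // -normCK.
by move/eqP; rewrite sqrp_eq1 // => /eqP.
Qed.

Lemma Fab0x b c : Fab 0 b c = 1.
Proof.
case: (umtc_Fnorm C) => norm0 _ _; have p := fus_ab_gt0 b c.
by have := norm0 _ _ _ (Ordinal p) (Ordinal p); rewrite /Fab !add0r eqxx.
Qed.

Lemma Fabx0 a c : Fab a 0 c = 1.
Proof.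
case: (umtc_Fnorm C) => _ norm0 _; have p := fus_ab_gt0 a c.
by have := norm0 _ _ _ (Ordinal p) (Ordinal p); rewrite /Fab addr0 add0r eqxx.
Qed.

Lemma Fabxx0 a b : Fab a b 0 = 1.
Proof.
case: (umtc_Fnorm C) => _ _ norm0; have p := fus_ab_gt0 a b.
by have := norm0 _ _ _ (Ordinal p) (Ordinal p); rewrite /Fab !addr0 eqxx.
Qed.

Lemma Rab_norm a b : `|Rab a b| = 1.
Proof.
pose x := Ordinal (fus_ab_gt0 a b).
pose r u := Rsym (val a) (val b) (val (a + b)) 0%N u.
have := @umtc_Runit R C _ _ _ x x.
rewrite eqxx (sum_fus_ab (fun u => r u * (r u)^*)) 1?addrC // -normCK.
by move/eqP; rewrite sqrp_eq1 // => /eqP.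
Qed.

(* For two trivial anyons the hexagon reads [b * b = b]; [B] is the braiding or its
   inverse. *)
Lemma hexagon_vac (B : C -> C -> C -> nat -> nat -> R[i]) a : hexagon_for B ->
  B (val a) (val (0 : A)) (val a) 0%N 0%N != 0 ->
  B (val a) (val (0 : A)) (val a) 0%N 0%N = 1.
Proof.
set b := B _ _ _ _ _ => hexB b0.
have p : (0 < fus (val a) (val (0 : A)%R) (val a))%N.
  by rewrite -{2}[a]addr0 fus_ab_gt0.
have q : (0 < fus (val (0 : A)%R) (val a) (val a))%N.
  by rewrite -{2}[a]add0r fus_ab_gt0.
pose o : C := val (0 : A); pose x := val a.
pose S s t := B x o x 0%N s * Fsym o x o x (x, s, 0%N) (x, t, 0%N) * B x o x t 0%N.
pose T f s t r := Fsym x o o x (x, 0%N, 0%N) (f, s, t) * B x f x t r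
  * Fsym o o x x (f, s, r) (x, 0%N, 0%N).
have ST : \sum_(s < fus o x x) \sum_(t < fus x o x) S s t =
    \sum_f \sum_(s < fus o o f) \sum_(t < fus x f x) \sum_(r < fus f x x) T f s t r.
  exact: hexB (Ordinal p) (Ordinal p) (Ordinal q) (Ordinal q).
have {ST} : S 0%N 0%N = T o 0%N 0%N 0%N.
  move: ST; rewrite (sum_fus_ab (fun s => \sum_(t < _) S s t)) ?add0r //.
  rewrite (sum_fus_ab (S 0%N)) ?addr0 //.
  rewrite (sum_anyon_fus_ab 0 0 (fun f s =>
    \sum_(t < fus x f x) \sum_(r < fus f x x) T f s t r)).
  rewrite addr0 (sum_fus_ab (fun t => \sum_(r < _) T _ _ t r)) ?addr0 //.
  by rewrite (sum_fus_ab (T _ _ _)) ?add0r.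
have := Fabx0 0 a; have := Fabxx0 a 0; have := Fabxx0 0 a.
rewrite /Fab /S /T !addr0 !add0r => -> -> ->.
by rewrite mulr1 mulr1 mul1r -/b -{3}[b]mul1r => /(mulIf b0).
Qed.

Lemma Rabx0 a : Rab a 0 = 1.
Proof.
have R1 := Rab_norm a 0; rewrite /Rab addr0 in R1 *.
by apply: hexagon_vac (umtc_hexagons C).1 _; rewrite -normr_eq0 R1 oner_eq0.
Qed.

(** The inverse braiding of [a] with [0] is the conjugate of [Rab 0 a], so this case comes from the
    second hexagon. *)
Lemma Rab0x a : Rab 0 a = 1.
Proof.
have R1 := Rab_norm 0 a; rewrite /Rab add0r in R1 *.
apply: (can_inj conjCK); rewrite conjC1.
apply: (hexagon_vac (umtc_hexagons C).2).
by rewrite -normr_eq0 norm_conjC R1 oner_eq0.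
Qed.

Lemma Fab_mulrb a (x y z : bool) :
  Fab (a *+ x) (a *+ y) (a *+ z) = if [&& x, y & z] then Fab a a a else 1.
Proof. by case: x y z => [] [] []; rewrite ?mulr1n ?Fab0x ?Fabx0 ?Fabxx0. Qed.

Lemma Rab_mulrb a (x y : bool) :
  Rab (a *+ x) (a *+ y) = if x && y then Rab a a else 1.
Proof. by case: x y => [] []; rewrite ?mulr1n ?Rab0x ?Rabx0. Qed.

End AbelianSymbols.

(** * The unit circle parametrized by [0, 1) through [expi] *)

Section Phases.
Variable R : realType.
Implicit Types (s t x z : R) (w : R[i]).

Lemma expiD s t : expi (s + t) = expi s * expi t.
Proof.
rewrite /expi cosD sinD; apply/eqP.
by rewrite eq_complex /= eqxx /= addrC.
Qed.

Lemma expi_norm t : `|expi t| = 1.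
Proof. by rewrite normc_def /= cos2Dsin2 sqrtr1. Qed.

Lemma expi_neq0 t : expi t != 0.
Proof. by rewrite -normr_eq0 expi_norm oner_eq0. Qed.

Lemma expi0 : expi 0 = 1 :> R[i].
Proof. by rewrite /expi cos0 sin0. Qed.

Lemma expiN t : expi (- t) = (expi t)^-1.
Proof.
by apply: (mulfI (expi_neq0 t)); rewrite -expiD subrr expi0 divff ?expi_neq0.
Qed.

Lemma expiMn t n : expi (t *+ n) = expi t ^+ n.
Proof. by elim: n => [|n IHn]; rewrite ?expi0 // mulrS expiD IHn exprS. Qed.

Lemma expi_2pi_int (m : int) : expi (2 * pi * m%:~R) = 1 :> R[i].
Proof.
have expi_2pi_nat n : expi (2 * pi * n%:R) = 1 :> R[i].
  by rewrite mulr_natr expiMn /expi mulr_natl cos2pi sin2pi expr1n.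
case: m => n; first exact: expi_2pi_nat.
by rewrite NegzE mulrNz mulrN expiN expi_2pi_nat invr1.
Qed.

Lemma expi_2piDz x (m : int) : expi (2 * pi * (x + m%:~R)) = expi (2 * pi * x).
Proof. by rewrite mulrDr expiD expi_2pi_int mulr1. Qed.

Lemma frac_itv x : 0 <= frac x < 1.
Proof.
have /andP[] := floor_itv x; rewrite intrD /frac => xl xu.
by apply/andP; split; lra.
Qed.

Lemma subr_frac x : x - frac x = (Num.floor x)%:~R.
Proof. by rewrite /frac subKr. Qed.

Lemma expi_frac x : expi (2 * pi * frac x) = expi (2 * pi * x).
Proof. by rewrite -[in RHS](subrK (Num.floor x)%:~R x) expi_2piDz. Qed.

(** For f the fractional part of [x], the double-angle formula turns cos(2 pi f) = 1 into sin(pi f)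
    = 0, while sin is positive on (0, pi). *)
Lemma expi_2pi_eq1 x : expi (2 * pi * x) = 1 -> x = (Num.floor x)%:~R.
Proof.
rewrite -expi_frac => /(congr1 (@complex.Re R)) /= cos1.
apply/eqP; rewrite -subr_eq0 -/(frac x); apply/eqP.
have /andP[] := frac_itv x; rewrite le_eqVlt => /orP[/eqP <- //|f_gt0 f_lt1].
have sin_gt0 : 0 < sin (pi * frac x).
  by apply: sin_gt0_pi; rewrite mulr_gt0 ?pi_gt0 //= gtr_pMr ?pi_gt0.
move: cos1; rewrite -mulrA mulr_natl cos_mulr2n => cos1.
have := cos2Dsin2 (pi * frac x).
by have := exprn_gt0 2 sin_gt0; lra.
Qed.

Lemma expi_2pi_inj x z : 0 <= x < 1 -> 0 <= z < 1 ->
  expi (2 * pi * x) = expi (2 * pi * z) -> x = z.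
Proof.
move=> /andP[x0 x1] /andP[z0 z1] xz.
have /expi_2pi_eq1 : expi (2 * pi * (x - z)) = 1.
  by rewrite mulrBr expiD expiN xz divff ?expi_neq0.
(* [x - z] is an integer strictly between -1 and 1, so only 0 survives. *)
have [m_lt0|m_gt0|->] := ltrgtP (Num.floor (x - z)) 0; last first.
- by move/eqP; rewrite subr_eq0 => /eqP.
- have : (1 <= Num.floor (x - z))%R by lia.
  by rewrite -(ler_int R); lra.
- have : (Num.floor (x - z) <= -1)%R by lia.
  by rewrite -(ler_int R); lra.
Qed.

Lemma expi_surj w : `|w| = 1 -> exists z, 0 <= z < 1 /\ w = expi (2 * pi * z).
Proof.
case: w => a b; rewrite normc_def /= => /(congr1 (@complex.Re R)) /= ab1.
have {}ab1 : a ^+ 2 + b ^+ 2 = 1.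
  by rewrite -[LHS]sqr_sqrtr ?ab1 ?expr1n // addr_ge0 ?sqr_ge0.
have a_itv : -1 <= a <= 1 by apply/andP; split; have := sqr_ge0 b; nra.
(* The sine of [acos a] is nonnegative, hence [|b|]; the sign of [b] decides between [acos a] and
   its negative. *)
have [t [cost sint]] : exists t, cos t = a /\ sin t = b.
  have sin_acosE : sin (acos a) = `|b|.
    by rewrite sin_acos // -sqrtr_sqr; congr Num.sqrt; lra.
  have [b0|b0] := leP 0 b.
    by exists (acos a); rewrite acosK // sin_acosE ger0_norm.
  by exists (- acos a); rewrite cosN sinN acosK // sin_acosE ltr0_norm ?opprK.
exists (frac (t / (2 * pi))); split; first exact: frac_itv.
rewrite expi_frac mulrC divfK; first by rewrite /expi cost sint.
by rewrite mulf_neq0 // gt_eqF ?pi_gt0.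
Qed.

(** By [expi_surj] the set defining [phase w] is nonempty, so the default 0 does not intervene. *)
Lemma phase_itv w : `|w| = 1 -> 0 <= phase w < 1.
Proof. by move=> /expi_surj /(xgetPex 0) []. Qed.

Lemma expi_phase w : `|w| = 1 -> expi (2 * pi * phase w) = w.
Proof. by move=> /expi_surj /(xgetPex 0) [_ <-]. Qed.

Lemma phase_expi z : 0 <= z < 1 -> phase (expi (2 * pi * z)) = z.
Proof.
move=> z01; have n1 := expi_norm (2 * pi * z).
by apply: expi_2pi_inj; rewrite ?phase_itv ?expi_phase.
Qed.

Lemma floor_lt2 x : 0 <= x < 2 -> Num.floor x = (1 <= x)%R%:Z.
Proof.
case/andP=> x0 x2; apply: floor_def; case: (leP 1 x) => x1 /=.
  by rewrite x1 x2.
by rewrite x0 x1.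
Qed.

(** * Real coordinates on U(1) and on the M-th roots of unity *)

Definition U1_phase (g : U1 R) : R := phase (val g).

Lemma U1_norm (g : U1 R) : `|val g| = 1.
Proof. exact: eqP (valP g). Qed.

Lemma U1_phase_itv g : 0 <= U1_phase g < 1.
Proof. exact: phase_itv (U1_norm g). Qed.

Lemma floor_U1_phase g h :
  Num.floor (U1_phase g + U1_phase h) = (1 <= U1_phase g + U1_phase h)%R%:Z.
Proof.
have /andP[g0 g1] := U1_phase_itv g; have /andP[h0 h1] := U1_phase_itv h.
by apply: floor_lt2; apply/andP; split; lra.
Qed.

(** Phases add modulo 1, and a sum of two phases lies in [0, 2), so the integer part removed is 0 or
    1. *)
Lemma U1_phaseM g h : U1_phase (g * h)%g =
  U1_phase g + U1_phase h - (1 <= U1_phase g + U1_phase h)%R%:R.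
Proof.
transitivity (frac (U1_phase g + U1_phase h)); last first.
  by rewrite /frac floor_U1_phase.
rewrite -[RHS]phase_expi ?frac_itv // expi_frac mulrDr expiD.
by rewrite /U1_phase !expi_phase ?U1_norm.
Qed.

(** Since the M-th power of [g] is 1, M times its phase is an integer; it is below M because the
    phase is below 1, so it witnesses the set defining [residue]. *)
Lemma Zroot_phase M (g : Zroot R M) : (0 < M)%N ->
  (residue g < M)%N /\ U1_phase (val g) = (residue g)%:R / M%:R.
Proof.
move=> M0; have MR0 : 0 < M%:R :> R by rewrite ltr0n.
have [z0 z1] := andP (U1_phase_itv (val g)); set z := U1_phase _ in z0 z1 *.
have gE : val (val g) = expi (2 * pi * z) by rewrite expi_phase ?U1_norm.
have valX (u : U1 R) n : val (u ^+ n)%g = val u ^+ n.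
  by elim: n => [|n IHn] //; rewrite expgS exprS -IHn.
have /expi_2pi_eq1 zM : expi (2 * pi * (z * M%:R)) = 1.
  rewrite mulrA mulr_natr expiMn -gE -valX.
  by have /eqP -> := valP g.
have zM0 : (0 <= Num.floor (z * M%:R)) by rewrite floor_ge0 mulr_ge0 ?ler0n.
case: (Num.floor _) zM zM0 => // n zM _.
have res_ex : exists h, (h < M)%N /\ val (val g) = expi (2 * pi * h%:R / M%:R).
  exists n; split; last by rewrite -mulrA -[n%:R]zM mulfK ?gt_eqF.
  by rewrite -(ltr_nat R) -[n%:R]zM gtr_pMl.
have [lt_rM rE] := xgetPex 0%N res_ex; split=> //.
apply: expi_2pi_inj; first by apply/andP.
  by rewrite divr_ge0 //= ltr_pdivrMr // mul1r ltr_nat.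
by rewrite -gE mulrA; exact: rE.
Qed.

End Phases.

(** * The obstruction and its solution for a coordinate that is additive up to a carry *)

Section CarryCocycle.
Variables (R : realType) (C : umtc R) (G : groupType) (z : G -> R).
Local Notation A := (abAnyon C).
Implicit Types (g h k l : G) (v : A).

Let carry g h : bool := 1 <= z g + z h.

Hypothesis zM : forall g h, z (g * h)%g = z g + z h - (carry g h)%:R.

(** The common form of [wU1] and [wZ]; in both applications [z] is the angle in units of a full
    turn. *)
Definition carry_cocycle v g h : A := v *+ carry g h.

Definition carry_F v (m : int) g h k : R[i] :=
  expi (- (2 * pi * (spin v + m%:~R) * z g * (carry h k)%:R)).

(** Expanding [z] on the two bracketings of the triple product leaves equal totals of carries. *)
Lemma carry_coherence g h k :
  (carry g h + carry (g * h)%g k = carry h k + carry g (h * k)%g)%N.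
Proof.
apply/eqP; rewrite -(eqr_nat R) !natrD; apply/eqP.
by have := congr1 z (mulgA g h k); rewrite !zM; lra.
Qed.

Lemma carry_andb g h k :
  carry g h && carry (g * h)%g k = carry h k && carry g (h * k)%g.
Proof. by have := carry_coherence g h k; do 4!case: carry. Qed.

Lemma carry_cocycle2 v : cocycle2 (carry_cocycle v).
Proof. by move=> g h k; rewrite /carry_cocycle -!mulrnDr carry_coherence. Qed.

Lemma carry_obstruction v g h k l :
  obstruction (carry_cocycle v) g h k l =
  Rab (carry_cocycle v g h) (carry_cocycle v k l).
Proof.
have F0 : Fab v v v != 0 by rewrite -normr_eq0 Fab_norm oner_eq0.
have divF (b : bool) :
    (if b then Fab v v v else 1) / (if b then Fab v v v else 1) = 1.
  by case: b; rewrite ?divff ?divr1.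
rewrite /obstruction /carry_cocycle !Fab_mulrb.
(* The first quotient of [F]-symbols cancels by symmetry of the conjunction, the other two by
   [carry_andb]. *)
by rewrite !andbA !carry_andb (andbC (carry k l)) !divF !mul1r.
Qed.

(** An integer shift of the spin leaves the exponential unchanged, which is why [k1] and [k3] are
    free. *)
Lemma Rab_spin v (m : int) (x y : bool) :
  Rab (v *+ x) (v *+ y) = expi (2 * pi * (spin v + m%:~R) * (x * y)%:R).
Proof.
rewrite Rab_mulrb mulnb; case: (x && y); last by rewrite mulr0 expi0.
by rewrite mulr1 expi_2piDz expi_phase ?Rab_norm.
Qed.

Lemma carry_solution v m : defectF_solution (carry_cocycle v) (carry_F v m).
Proof.
split=> [g h k|g h k l]; first exact: expi_norm.
rewrite carry_obstruction (Rab_spin v m) /carry_F -!expiD -expiN -expiD.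
congr expi; rewrite !zM natrM.
(* The coefficient of [z g] vanishes by coherence for [h], [k], [l]; what remains is the carry term
   from expanding [z (g * h)]. *)
have /eqP := carry_coherence h k l; rewrite -(eqr_nat R) !natrD => /eqP E.
have -> : (carry (h * k)%g l)%:R =
  (carry k l)%:R + (carry h (k * l)%g)%:R - (carry h k)%:R :> R by lra.
ring.
Qed.

End CarryCocycle.

(** * Both groups as instances of the carry construction *)

Theorem mainTheorem13 (R : realType) (C : umtc R) :
  (forall v : abAnyon C,
     [/\ cocycle2 (wU1 v),
         forall g h k l : U1 R,
           obstruction (wU1 v) g h k l = Rab (wU1 v g h) (wU1 v k l)
       & forall k1 : int, defectF_solution (wU1 v) (FU1 v k1)])
  /\
  (forall (M : nat) (s : abAnyon C), (0 < M)%N ->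
     [/\ cocycle2 (@wZ R C M s),
         forall g h k l : Zroot R M,
           obstruction (wZ s) g h k l = Rab (wZ s g h) (wZ s k l)
       & forall k3 : int, defectF_solution (@wZ R C M s) (FZ s k3)]).
Proof.
have phaseM := @U1_phaseM R.
split=> [v | M s M0].
  have -> : wU1 v = carry_cocycle (@U1_phase R) v.
    apply/funext => g; apply/funext => h.
    rewrite /wU1 -/(U1_phase g) -/(U1_phase h) subr_frac.
    by rewrite intrKfloor floor_U1_phase.
  have FE m : FU1 v m = carry_F (@U1_phase R) v m.
    apply/funext => g; apply/funext => h; apply/funext => k.
    rewrite /FU1 -/(U1_phase g) -/(U1_phase h) -/(U1_phase k).
    by rewrite subr_frac floor_U1_phase.
  split=> [|g h k l|m]; first exact: carry_cocycle2.
    exact: carry_obstruction.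
  by rewrite FE; exact: carry_solution.
pose z (g : Zroot R M) := U1_phase (val g).
have zM g h : z (g * h)%g = z g + z h - (1 <= z g + z h)%R%:R by exact: phaseM.
have MR0 : M%:R != 0 :> R by rewrite pnatr_eq0 -lt0n.
have carryE g h : ((residue g + residue h) %/ M = (1 <= z g + z h)%R)%N.
  have [gM gE] := Zroot_phase g M0; have [hM hE] := Zroot_phase h M0.
  rewrite /z gE hE -mulrDl ler_pdivlMr ?ltr0n // mul1r -natrD ler_nat.
  (* Both residues are below [M], so their sum is below 2M and the quotient is 0 or 1. *)
  case: leqP => [le_M|]; last exact: divn_small.
  by rewrite -[X in (X %/ _)%N](subnK le_M) divnDr // divnn M0 divn_small //; lia.
have subE (n : nat) : (n - n %% M = n %/ M * M)%N.
  by rewrite {1}(divn_eq n M) addnK.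
have -> : wZ s = carry_cocycle z s.
  apply/funext => g; apply/funext => h.
  by rewrite /wZ subE mulnK // carryE.
have FE m : FZ s m = carry_F z s m.
  apply/funext => g; apply/funext => h; apply/funext => k.
  rewrite /FZ subE carryE /carry_F.
  have -> : z g = (residue g)%:R / M%:R := (Zroot_phase g M0).2.
  (* Of the two factors [M] in the denominator, one scales the residue of [g] to [z g] and the other
     cancels the [M] multiplying the carry. *)
  by congr (expi (- _)); rewrite !natrM; field.
split=> [|g h k l|m]; first exact: carry_cocycle2.
  exact: carry_obstruction.
by rewrite FE; exact: carry_solution.
Qed.
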